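(* Define $L(x,t):=\left(\dfrac{x^t+x}{x+1}\right)\left(\dfrac{x^t+1}{x^t+x}\right)^t$ for $x>0$ and $t\in\mathbb R$, and let $K(x,t)$ be the generalized Kantorovich constant. (I) If $0\le t\le 1$, then $L(x,t)\le K(x,t)$ for all $x>0$. (II) If $t\ge 1$ or $t\le 0$, then $L(x,t)\ge K(x,t)$ for all $x>0$.
   Context: The generalized Kantorovich constant is, for $x>0$, $t\in\mathbb R$, \[K(x,t)=\frac{x^t-x}{(t-1)(x-1)}\left(\frac{t-1}{t}\,\frac{x^t-1}{x^t-x}\right)^t,\] where the undefined cases are given by limits: $K(1,t)=1$ for all $t$, and $K(x,0)=K(x,1)=1$ for all $x>0$. *)

(* Defs.v *)
From Stdlib Require Import Reals.
Open Scope R_scope.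

(** The generalized Kantorovich constant, for x > 0.  At x = 1, t = 0 and t = 1
    the closed formula contains 0/0, and the value is the limit, which is 1.
    Elsewhere x^t - 1 and t (x - 1) have the same sign, as do x^t - x and
    (t - 1) (x - 1), so the base of the outer power is positive, which [Rpower]
    requires. *)
Definition K (x t : R) : R :=
  if Req_dec_T x 1 then 1
  else if Req_dec_T t 0 then 1
  else if Req_dec_T t 1 then 1
  else (Rpower x t - x) / ((t - 1) * (x - 1))
       * Rpower ((t - 1) / t * ((Rpower x t - 1) / (Rpower x t - x))) t.

Definition L (x t : R) : R :=
  (Rpower x t + x) / (x + 1)
  * Rpower ((Rpower x t + 1) / (Rpower x t + x)) t.

(* Main.v *)
(** Write [x = exp (2 s)] and let [phi u = ln (tanh u / u)], an even function. Then
    [ln K - ln L = (1 - t) phi ((1 - t) s) + t phi (t s) - phi s].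
    Among [s], [t s], [(1 - t) s], one has absolute value the sum of the other two,
    so both inequalities follow from the fact that [phi] decreases in [|u|]. *)
Require Import Defs.
From Stdlib Require Import Reals.
From Stdlib Require Import Lra.
From Coquelicot Require Import Coquelicot.
Open Scope R_scope.

Lemma exp_add_exp_opp_ge_2 (u : R) : 2 <= exp u + exp (- u).
Proof.
assert (H := exp_ineq1_le u). assert (H' := exp_ineq1_le (- u)). lra.
Qed.

(** The difference of the two sides vanishes at 0, and its derivative [exp v + exp (- v) - 2] is
    nonnegative. *)
Lemma sinh_ge_id (u : R) : 0 < u -> 2 * u <= exp u - exp (- u).
Proof.
intros Hu.
destruct (MVT_cor2 (fun v => exp v - exp (- v) - 2 * v)
  (fun v => exp v + exp (- v) - 2) 0 u Hu) as [c [Hc _]].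
{ intros c _. apply is_derive_Reals. auto_derive; [easy | ring]. }
rewrite Ropp_0, exp_0 in Hc.
assert (H := exp_add_exp_opp_ge_2 c).
nra.
Qed.

Lemma tanh_exp (u : R) : tanh u = (exp (2 * u) - 1) / (exp (2 * u) + 1).
Proof.
unfold tanh, sinh, cosh.
rewrite exp_Ropp.
replace (2 * u) with (u + u) by ring.
rewrite exp_plus.
assert (H := exp_pos u).
field. repeat split; nra.
Qed.

(** This is [exp (phi u)]. At 0 it takes the value 0 instead of the limit 1, so positivity and
    monotonicity are stated away from 0. *)
Definition tanhc (u : R) : R := tanh u / u.

Lemma tanhc_opp (u : R) : tanhc (- u) = tanhc u.
Proof.
destruct (Req_dec u 0) as [-> | Hu]; [now rewrite Ropp_0 |].
unfold tanhc, tanh, sinh, cosh.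
rewrite Ropp_involutive.
assert (H := exp_pos u). assert (H' := exp_pos (- u)).
field. repeat split; lra.
Qed.

Lemma tanhc_Rabs (u : R) : tanhc (Rabs u) = tanhc u.
Proof.
unfold Rabs; destruct (Rcase_abs u); [apply tanhc_opp | easy].
Qed.

Lemma tanhc_pos (u : R) : u <> 0 -> 0 < tanhc u.
Proof.
intros Hu. apply Rabs_pos_lt in Hu.
rewrite <- tanhc_Rabs. set (v := Rabs u) in *.
unfold tanhc, tanh, sinh, cosh.
assert (H1 := exp_pos v). assert (H2 := exp_pos (- v)).
assert (H3 := sinh_ge_id v Hu).
repeat apply Rdiv_lt_0_compat; lra.
Qed.

Lemma tanhc_decr_pos (u w : R) : 0 < u -> u < w -> tanhc w <= tanhc u.
Proof.
intros Hu Huw.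
(* The numerator of the derivative is [4 v - 2 sinh (2 v)], which is nonpositive by [sinh_ge_id] at
   [2 v]. *)
destruct (MVT_cor2 tanhc
  (fun v => (4 * v - (exp (2 * v) - exp (- (2 * v))))
            / (v * (exp v + exp (- v))) ^ 2) u w Huw) as [c [Hc [Huc Hcw]]].
{ intros c [Hc _]. apply is_derive_Reals.
  assert (H1 := exp_pos c). assert (H2 := exp_pos (- c)).
  unfold tanhc, tanh, sinh, cosh.
  auto_derive; [repeat split; lra |].
  replace (- (2 * c)) with (- c + - c) by ring.
  replace (2 * c) with (c + c) by ring.
  rewrite !exp_plus, !exp_Ropp.
  field. repeat split; nra. }
assert (Hs := sinh_ge_id (2 * c) ltac:(lra)).
assert (H1 := exp_pos c). assert (H2 := exp_pos (- c)).
assert (Hd : 0 < / (c * (exp c + exp (- c))) ^ 2).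
{ apply Rinv_0_lt_compat, pow_lt. nra. }
unfold Rdiv in Hc.
set (d := / _) in *.
assert (0 <= (exp (2 * c) - exp (- (2 * c)) - 4 * c) * d * (w - u)).
{ repeat apply Rmult_le_pos; lra. }
lra.
Qed.

Lemma ln_tanhc_decr (u w : R) :
  u <> 0 -> Rabs u <= Rabs w -> ln (tanhc w) <= ln (tanhc u).
Proof.
intros Hu Huw.
assert (Hu' := Rabs_pos_lt u Hu).
rewrite <- (tanhc_Rabs u), <- (tanhc_Rabs w).
apply ln_le.
- apply tanhc_pos. lra.
- destruct Huw as [Huw | ->]; [now apply tanhc_decr_pos | lra].
Qed.

Definition log_gap (s t : R) : R :=
  (1 - t) * ln (tanhc ((1 - t) * s)) + t * ln (tanhc (t * s)) - ln (tanhc s).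

(** Here [s] has the largest absolute value, so a weighted mean of two values of [phi] is compared
    with a smaller one. *)
Lemma log_gap_nonneg (s t : R) : s <> 0 -> 0 < t < 1 -> 0 <= log_gap s t.
Proof.
intros Hs Ht. unfold log_gap.
assert (H := Rabs_pos s).
assert (H1 : ln (tanhc s) <= ln (tanhc (t * s))).
{ apply ln_tanhc_decr; [apply Rmult_integral_contrapositive; lra |].
  rewrite Rabs_mult, (Rabs_pos_eq t); nra. }
assert (H2 : ln (tanhc s) <= ln (tanhc ((1 - t) * s))).
{ apply ln_tanhc_decr; [apply Rmult_integral_contrapositive; lra |].
  rewrite Rabs_mult, (Rabs_pos_eq (1 - t)); nra. }
nra.
Qed.

(** This reflection carries the case [t < 0] to the case [t > 1]. *)
Lemma log_gap_sym (s t : R) : log_gap s (1 - t) = log_gap s t.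
Proof.
unfold log_gap. replace (1 - (1 - t)) with t by ring. ring.
Qed.

(** Now [t * s] has the largest absolute value, and the gap equals [(t - 1) (phi (t s) - phi ((1 -
    t) s)) + (phi (t s) - phi s)], a sum of two nonpositive terms. *)
Lemma log_gap_nonpos_gt1 (s t : R) : s <> 0 -> 1 < t -> log_gap s t <= 0.
Proof.
intros Hs Ht. unfold log_gap.
assert (H := Rabs_pos s).
assert (H1 : ln (tanhc (t * s)) <= ln (tanhc s)).
{ apply ln_tanhc_decr; [easy |].
  rewrite Rabs_mult, (Rabs_pos_eq t); nra. }
assert (H2 : ln (tanhc (t * s)) <= ln (tanhc ((1 - t) * s))).
{ apply ln_tanhc_decr; [apply Rmult_integral_contrapositive; lra |].
  rewrite !Rabs_mult, (Rabs_pos_eq t), (Rabs_left (1 - t)); nra. }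
nra.
Qed.

Lemma log_gap_nonpos (s t : R) :
  s <> 0 -> 1 < t \/ t < 0 -> log_gap s t <= 0.
Proof.
intros Hs [Ht | Ht]; [now apply log_gap_nonpos_gt1 |].
rewrite <- log_gap_sym. apply log_gap_nonpos_gt1; lra.
Qed.

Lemma L_pos (x t : R) : 0 < x -> 0 < L x t.
Proof.
intros Hx. unfold L, Rpower.
assert (H := exp_pos (t * ln x)).
apply Rmult_lt_0_compat; [apply Rdiv_lt_0_compat; lra | apply exp_pos].
Qed.

Lemma K_eq_L_mul_exp_log_gap (x t : R) :
  0 < x -> x <> 1 -> t <> 0 -> t <> 1 ->
  K x t = L x t * exp (log_gap (ln x / 2) t).
Proof.
intros Hx Hx1 Ht0 Ht1.
unfold K. do 3 (destruct Req_dec_T; [easy |]).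
unfold L.
set (s := ln x / 2).
assert (Hs : s <> 0).
{ unfold s. assert (H := ln_neq_0 x Hx1 Hx). lra. }
set (y := Rpower x t).
assert (Ex : x = exp (2 * s)).
{ unfold s. replace (2 * (ln x / 2)) with (ln x) by field. now rewrite exp_ln. }
assert (Ey : y = exp (2 * (t * s))).
{ unfold y, Rpower, s. f_equal. field. }
assert (Hy : 0 < y) by apply exp_pos.
assert (Hts : t * s <> 0) by (apply Rmult_integral_contrapositive; lra).
assert (Hts' : (1 - t) * s <> 0) by (apply Rmult_integral_contrapositive; lra).
assert (P := tanhc_pos s Hs).
assert (Pt := tanhc_pos _ Hts).
assert (Pt' := tanhc_pos _ Hts').
(* With [y = x^t], each difference in [K] is the matching sum in [L] times a hyperbolic tangent,
   since [tanh u = (exp (2 u) - 1) / (exp (2 u) + 1)]. *)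
assert (E : x - 1 = s * (x + 1) * tanhc s).
{ unfold tanhc. rewrite tanh_exp, <- Ex. field. lra. }
assert (Et : y - 1 = t * s * (y + 1) * tanhc (t * s)).
{ unfold tanhc. rewrite tanh_exp, <- Ey. field. repeat split; lra. }
assert (Et' : y - x = (t - 1) * s * (y + x) * tanhc ((1 - t) * s)).
(* Evenness turns the argument into [t s - s], half the logarithm of [y / x]. *)
{ rewrite <- tanhc_opp. unfold tanhc.
  replace (- ((1 - t) * s)) with (t * s - s) by ring.
  rewrite tanh_exp.
  replace (2 * (t * s - s)) with (2 * (t * s) + - (2 * s)) by ring.
  rewrite exp_plus, exp_Ropp, <- Ex, <- Ey.
  field. repeat split; lra. }
unfold log_gap.
set (a := tanhc s) in *.
set (b := tanhc (t * s)) in *.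
set (c := tanhc ((1 - t) * s)) in *.
rewrite E, Et, Et'.
(* The factors [s], [t] and [t - 1] cancel: the prefactor of [L] gains [c / a] and the base of its
   power gains [b / c]. *)
replace ((t - 1) * s * (y + x) * c / ((t - 1) * (s * (x + 1) * a)))
  with ((y + x) / (x + 1) * (c / a)) by (field; repeat split; lra).
replace ((t - 1) / t * (t * s * (y + 1) * b / ((t - 1) * s * (y + x) * c)))
  with ((y + 1) / (y + x) * (b / c)) by (field; repeat split; lra).
rewrite <- Rpower_mult_distr by (apply Rdiv_lt_0_compat; lra).
replace ((1 - t) * ln c + t * ln b - ln a)
  with (ln (c / a) + t * ln (b / c)) by (rewrite !ln_div by easy; ring).
rewrite exp_plus, exp_ln by (apply Rdiv_lt_0_compat; lra).
fold (Rpower (b / c) t). ring.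
Qed.

Lemma L_eq_K_degenerate (x t : R) :
  0 < x -> x = 1 \/ t = 0 \/ t = 1 -> L x t = K x t.
Proof.
intros Hx H.
assert (EK : K x t = 1).
{ unfold K. do 3 (destruct Req_dec_T; [easy |]). tauto. }
rewrite EK. unfold L.
destruct H as [-> | [-> | ->]].
(* Occurrence 2 is the outer power, kept folded until its base has been reduced to 1. *)
- unfold Rpower at 1 3 4. rewrite ln_1, Rmult_0_r, exp_0.
  replace ((1 + 1) / (1 + 1)) with 1 by field.
  unfold Rpower. rewrite ln_1, Rmult_0_r, exp_0. ring.
- rewrite (Rpower_O x) by easy.
  rewrite Rpower_O by (apply Rdiv_lt_0_compat; lra).
  field. lra.
- rewrite (Rpower_1 x) by easy.
  rewrite Rpower_1 by (apply Rdiv_lt_0_compat; lra).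
  field. lra.
Qed.

Theorem theorem3p1 :
  (forall t : R, 0 <= t <= 1 -> forall x : R, 0 < x -> L x t <= K x t) /\
  (forall t : R, 1 <= t \/ t <= 0 -> forall x : R, 0 < x -> L x t >= K x t).
Proof.
assert (Hdeg : forall x t : R, {x = 1 \/ t = 0 \/ t = 1} +
                               {x <> 1 /\ t <> 0 /\ t <> 1}).
{ intros x t. destruct (Req_dec_T x 1), (Req_dec_T t 0), (Req_dec_T t 1); tauto. }
split; intros t Ht x Hx; assert (HL := L_pos x t Hx);
  (destruct (Hdeg x t) as [H | [Hx1 [Ht0 Ht1]]];
   [rewrite (L_eq_K_degenerate x t Hx H); lra |]);
  rewrite K_eq_L_mul_exp_log_gap by easy;
  assert (Hs : ln x / 2 <> 0) by (assert (H := ln_neq_0 x Hx1 Hx); lra).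
- assert (G := log_gap_nonneg _ t Hs ltac:(lra)).
  (* With [g] the gap, [exp g >= 1 + g >= 1], so multiplying the positive [L x t] by [exp g] does
     not decrease it. *)
  assert (H := exp_ineq1_le (log_gap (ln x / 2) t)). nra.
- assert (G := log_gap_nonpos _ t Hs ltac:(lra)).
  destruct G as [G | ->].
  + apply exp_increasing in G. rewrite exp_0 in G. nra.
  + rewrite exp_0. lra.
Qed.
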